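(* For all partitions $\lambda,\mu$ and all $\beta\in\mathbb C$, $$\Phi^{(\beta)}_{\lambda',\mu'}(y)=(-1)^{|\lambda|+|\mu|}\,\Phi^{(\beta)}_{\mu,\lambda}(-y).$$ In particular, $\Phi^{(\beta)}_{\lambda,\lambda'}(y)$ is an even polynomial in $y$.
   Context: Partitions $\lambda=(\lambda_1\ge\lambda_2\ge\dots)$, $|\lambda|=\sum\lambda_i$, $\ell(\lambda)$ = number of nonzero parts, conjugate partition $\lambda'_i=\#\{j:\lambda_j\ge i\}$. $\boldsymbol\delta_r=(r-1,\dots,1,0)$. Monic Laguerre polynomials $\widehat L_n^{(\beta)}(y)=\sum_{i=0}^n(-1)^{n+i}\binom ni(\beta+i+1)_{n-i}y^i$ with $(z)_m=\prod_{j=0}^{m-1}(z+j)$; $\psi_\pm^{(\beta)}(n,x)=e^{-x^2/2}x^{\frac12\pm\beta}\widehat L_n^{(\pm\beta)}(x^2)$. For strictly decreasing tuples $\boldsymbol m\in\mathbb N^r$, $\boldsymbol n\in\mathbb N^s$, $\Psi^{(\beta)}_{\boldsymbol m,\boldsymbol n}(x)$ is the Wronskian in $x$ of $\psi_+^{(\beta)}(m_1,x),\dots,\psi_+^{(\beta)}(m_r,x),\psi_-^{(\beta)}(n_1,x),\dots,\psi_-^{(\beta)}(n_s,x)$, and $\widetilde\Phi^{(\beta)}_{\boldsymbol m,\boldsymbol n}(y)\in\mathbb Z[\beta,y]$ is the polynomial, monic in $y$, with $\Psi^{(\beta)}_{\boldsymbol m,\boldsymbol n}(x)=\Delta(2\boldsymbol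 m+\beta,2\boldsymbol n-\beta)e^{-\frac12(r+s)x^2}x^{\frac12(r-s)^2+\beta(r-s)}\widetilde\Phi^{(\beta)}_{\boldsymbol m,\boldsymbol n}(x^2)$, where $\Delta(\boldsymbol v)=\prod_{i<j}(v_j-v_i)$. Define $\Phi^{(\beta)}_{\lambda,\mu}(y)=\widetilde\Phi^{(\beta-r+s)}_{\lambda+\boldsymbol\delta_r,\mu+\boldsymbol\delta_s}(y)$ for any $r\ge\ell(\lambda)$, $s\ge\ell(\mu)$ (this is independent of $r,s$); it is monic of degree $|\lambda|+|\mu|$ in $y$. *)

(* Defs.v *)
From HB Require Import structures.
From mathcomp Require Import all_boot all_order all_algebra.
From mathcomp Require Import complex.
From mathcomp Require Import Rstruct.
From Stdlib Require Rdefinitions.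
Set Implicit Arguments. Unset Strict Implicit. Unset Printing Implicit Defensive.
Import Order.TTheory GRing.Theory Num.Theory.
Local Open Scope ring_scope.

Definition CC := complex Rdefinitions.R.

Definition is_partition (l : seq nat) : bool :=
  sorted (fun x y : nat => (y <= x)%N) l && all (fun x => 0 < x)%N l.
Definition psize (l : seq nat) : nat := sumn l.
Definition conjp (l : seq nat) : seq nat :=
  mkseq (fun i => count (fun x => i < x)%N l) (head 0%N l).
Definition plus_delta (l : seq nat) (r : nat) : seq nat :=
  mkseq (fun i => nth 0%N l i + (r - 1 - i))%N r.

(* A = Q[beta]; beta is the indeterminate 'X of A.  Polynomials in the
   variable x (or y) are elements of {poly A}. *)
Notation A := {poly rat}.

Definition poch (z : A) (m : nat) : A := \prod_(j < m) (z + j%:R).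

Definition mlaguerre (c : A) (n : nat) : {poly A} :=
  \sum_(i < n.+1)
     ((-1) ^+ (n + i) * 'C(n, i)%:R * poch (c + (i.+1)%:R) (n - i)) *: 'X^i.

(* sign of the parameter: true for psi_+ (c = beta), false for psi_- (c = -beta) *)
Definition sparam (sg : bool) : A := if sg then 'X else - 'X.

(* psi_pm(n,x) = e^{-x^2/2} x^{a} Q(x), with a = 1/2 +- beta, Q(x) = L(x^2) *)
Definition expo (sg : bool) : A := (2%:R)^-1%:P + sparam sg.
Definition psipoly (sg : bool) (n : nat) : {poly A} :=
  mlaguerre (sparam sg) n \Po 'X^2.

(* j-th derivative: if g = e^{-x^2/2} x^{a-k} q(x) then
   g' = e^{-x^2/2} x^{a-k-1} (x q'(x) + (a-k) q(x) - x^2 q(x)).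
   derq a j q is the polynomial part of the j-th derivative of
   e^{-x^2/2} x^a q(x), which equals e^{-x^2/2} x^{a-j} (derq a j q)(x). *)
Fixpoint derq (a : A) (j : nat) (q : {poly A}) : {poly A} :=
  match j with
  | 0 => q
  | j'.+1 => let p := derq a j' q in
             'X * p^`() + (a - j'%:R)%:P * p - 'X^2 * p
  end.

(* the list of functions psi_+(m_1),...,psi_+(m_r),psi_-(n_1),...,psi_-(n_s) *)
Definition fam (ms ns : seq nat) : seq (bool * nat) :=
  [seq (true, m) | m <- ms] ++ [seq (false, n) | n <- ns].

(* Polynomial part W of the Wronskian:
   Wr(f_1..f_N)(x) = e^{-N x^2/2} x^{sum a_i - N(N-1)/2} W(x). *)
Definition wronskpoly (ms ns : seq nat) : {poly A} :=
  let F := fam ms ns in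
  \det (\matrix_(i < size ms + size ns, j < size ms + size ns)
          derq (expo (nth (true, 0%N) F i).1) j
               (psipoly (nth (true, 0%N) F i).1 (nth (true, 0%N) F i).2)).

Definition vdelta (ms ns : seq nat) : A :=
  let v := [seq (2 * m)%:R + 'X | m <- ms] ++ [seq (2 * n)%:R - 'X | n <- ns] in
  \prod_(i < size v) \prod_(j < size v | (i < j)%N) (v`_j - v`_i).

(* Since sum a_i - N(N-1)/2 = (r-s)^2/2 + beta(r-s) - (r(r-1)+s(s-1)),
   the defining identity of tilde Phi reads
      W(x) = Delta * x^{r(r-1)+s(s-1)} * tildePhi(x^2),
   so tildePhi has coefficients W_{e+2i} / Delta (exact division in Q[beta]). *)
Definition eshift (r s : nat) : nat := (r * (r - 1) + s * (s - 1))%N.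
Definition tildePhi (ms ns : seq nat) : {poly A} :=
  let W := wronskpoly ms ns in
  let e := eshift (size ms) (size ns) in
  \poly_(i < size W) (W`_(e + 2 * i) %/ vdelta ms ns).

Definition evbeta (b : CC) (P : {poly A}) : {poly CC} :=
  map_poly (fun c : A => (map_poly (@ratr CC) c).[b]) P.

Definition Phi (b : CC) (lam mu : seq nat) : {poly CC} :=
  let r := size lam in let s := size mu in
  evbeta (b - r%:R + s%:R) (tildePhi (plus_delta lam r) (plus_delta mu s)).

(* Main.v *)
Require Import Defs.
From HB Require Import structures.
From mathcomp Require Import all_boot all_order all_algebra.
From mathcomp Require Import perm fraction complex Rstruct ring zify.
Import Order.TTheory GRing.Theory Num.Theory.
Local Open Scope ring_scope.
Set Implicit Arguments. Unset Strict Implicit. Unset Printing Implicit Defensive.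

(** Up to a common gauge factor, the Wronskian is the determinant of the
    iterates of [x d/dx + sparam] on the rows [psipoly], an operator acting on
    [X^n] by the scalar [n + sparam].  Lowering a single Laguerre index is,
    up to a factor, the operator [2 m - x d/dx]; summing over the rows gives
      [(|lam| + |mu| - k) a_k(lam, mu) = - sum_c w(c) a_k((lam, mu) - c)]
    for the coefficient [a_k] of [y^k] in [Phi], where [c] runs over the corner
    boxes of [lam] and of [mu].  Together with [a_(|lam|+|mu|) = 1] this
    determines [Phi].  The weight [w(c)] is a product of Vandermonde ratios and
    of Laguerre factors; since the rows and the columns of a partition give
    complementary subsets of an initial segment of [nat] (Maya diagrams), it
    changes sign under [(lam', mu') <-> (mu, lam)], and the duality follows by
    induction on [|lam| + |mu|].  All this is done over the field [Q(beta)]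
    with [beta] transcendental; the quotients defining [tildePhi] need not be
    known to be exact, because a Euclidean quotient depends only on the
    fraction. *)

(** * Derivations and Vandermonde products *)

Section Determinants.
Variable R : comNzRingType.

(** Leibniz rule for the derivation x d/dx, applied to one factor at a time. *)
Lemma euler_prod (I : eqType) (r : seq I) (d : I -> R) (f : I -> {poly R}) :
  uniq r ->
  \sum_(i <- r) \prod_(j <- r)
      (if j == i then d i *: f j - 'X * (f j)^`() else f j)
    = (\sum_(i <- r) d i) *: \prod_(j <- r) f j
      - 'X * (\prod_(j <- r) f j)^`().
Proof.
elim: r => [|x r IHr] /=; first by rewrite !big_nil derivC mulr0 scale0r subr0.
case/andP=> xNr ur.
have e1 : \prod_(j <- r) (if j == x then d x *: f j - 'X * (f j)^`() else f j)
    = \prod_(j <- r) f j.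
  by apply: eq_big_seq => j jr; case: eqP jr xNr => // -> ->.
have e2 : \sum_(i <- r) \prod_(j <- x :: r)
        (if j == i then d i *: f j - 'X * (f j)^`() else f j)
    = \sum_(i <- r) f x * \prod_(j <- r)
        (if j == i then d i *: f j - 'X * (f j)^`() else f j).
  by apply: eq_big_seq => i ir; rewrite big_cons; case: eqP ir xNr => // -> ->.
rewrite big_cons e2 !big_cons eqxx e1 derivM.
by rewrite -mulr_sumr IHr // -!mul_polyC rmorphD /=; ring.
Qed.

(** Each term of the expansion takes one entry from every row and [d] depends on the row only, so
    [euler_prod] gives the same scalar for every permutation. *)
Lemma euler_det n (M : 'M[{poly R}]_n) (d : 'I_n -> R) :
  \sum_i \det (\matrix_(a, b)
      (if a == i then d i *: M a b - 'X * (M a b)^`() else M a b))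
    = (\sum_i d i) *: \det M - 'X * (\det M)^`().
Proof.
rewrite /determinant exchange_big /= (raddf_sum (@deriv R)) /=.
rewrite scaler_sumr mulr_sumr -sumrB.
apply: eq_bigr => s _; rewrite -mulr_sumr.
have -> : \sum_(i < n) \prod_(i0 < n)
    (\matrix_(a, b) (if a == i then d i *: M a b - 'X * (M a b)^`()
                     else M a b)) i0 (s i0)
  = (\sum_i d i) *: \prod_(j < n) M j (s j)
    - 'X * (\prod_(j < n) M j (s j))^`().
  rewrite -(euler_prod d (fun j => M j (s j)) (index_enum_uniq _)).
  by apply: eq_bigr => i _; apply: eq_bigr => j _; rewrite mxE.
by case: (odd_perm s); rewrite ?expr1 ?expr0 ?mul1r ?mulN1r ?derivN
  -?mul_polyC; ring.
Qed.

Lemma det_rowZ n (M : 'M[R]_n) (i0 : 'I_n) (c : R) (v : 'I_n -> R) :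
  \det (\matrix_(a, b) (if a == i0 then c * v b else M a b))
    = c * \det (\matrix_(a, b) (if a == i0 then v b else M a b)).
Proof.
rewrite /determinant mulr_sumr; apply: eq_bigr => s _.
rewrite mulrCA; congr (_ * _).
rewrite (bigD1 i0) //= [in RHS](bigD1 i0) //= !mxE eqxx mulrA; congr (_ * _).
by apply: eq_bigr => j /negbTE ji; rewrite !mxE ji.
Qed.

Lemma coef_prod_top (I : Type) (r : seq I) (f : I -> {poly R}) (d : I -> nat) :
  (forall i, size (f i) <= (d i).+1)%N ->
  (size (\prod_(i <- r) f i)%R <= (\sum_(i <- r) d i).+1)%N
  /\ (\prod_(i <- r) f i)`_(\sum_(i <- r) d i)%N = \prod_(i <- r) (f i)`_(d i).
Proof.
move=> sf; elim: r => [|x r [IHs IHc]].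
  by rewrite !big_nil size_poly1 coef1.
rewrite !big_cons; split.
  apply: (leq_trans (size_polyMleq _ _)).
  by have := sf x; lia.
rewrite -IHc coefM.
have lt_dx : (d x < (d x + \sum_(i <- r) d i).+1)%N by lia.
rewrite (bigD1 (Ordinal lt_dx)) //=.
rewrite addKn [X in _ + X]big1 ?addr0 // => j.
rewrite -val_eqE /= => jd.
case: (ltnP (d x) j) => h.
  by rewrite nth_default ?mul0r //; apply: leq_trans (sf x) _.
rewrite mulrC nth_default ?mul0r //; apply: leq_trans IHs _.
by move/eqP: jd; move: (ltn_ord j); lia.
Qed.

Lemma coef_det_top n (M : 'M[{poly R}]_n) (d : 'I_n -> nat) :
  (forall i j, size (M i j) <= (d i).+1)%N ->
  (\det M)`_(\sum_i d i) = \det (\matrix_(i, j) (M i j)`_(d i)).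
Proof.
move=> sM; rewrite /determinant coef_sum; apply: eq_bigr => s _.
have [_ /= c] := coef_prod_top (index_enum _) (fun i => sM i (s i)).
have -> : \prod_(i < n) (\matrix_(i, j) (M i j)`_(d i)) i (s i)
   = \prod_(i < n) (M i (s i))`_(d i) by apply: eq_bigr => i _; rewrite mxE.
by rewrite -c; case: (odd_perm s); rewrite ?expr1 ?expr0 ?mul1r ?mulN1r ?coefN.
Qed.

(** A column operation: [L] does not depend on the row, so it acts as a product with a unitriangular
    matrix. *)
Lemma det_unitrig_comb n (P Q : 'M[R]_n) (L : nat -> nat -> R) :
  (forall i j : 'I_n, P i j = \sum_(k < n) L j k * Q i k) ->
  (forall j, L j j = 1) -> (forall j k, (j < k)%N -> L j k = 0) ->
  \det P = \det Q.
Proof.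
move=> PQ L1 L0.
have -> : P = Q *m (\matrix_(j, k) L j k)^T.
  apply/matrixP=> i j; rewrite PQ mxE; apply: eq_bigr => k _.
  by rewrite !mxE mulrC.
rewrite det_mulmx det_tr -[RHS]mulr1; congr (_ * _).
rewrite det_trig; last by apply/is_trig_mxP => i j ij; rewrite mxE L0.
by rewrite big1 // => i _; rewrite mxE L1.
Qed.

(** Only the factors that involve [i0] change, and the sign due to the order i < j is the same for
    [v i0] and [z]. The cross-multiplied form avoids division in [R]. *)
Lemma vandermonde_update n (v : 'I_n -> R) (i0 : 'I_n) (z : R) :
  let w := fun i => if i == i0 then z else v i in
  (\prod_(i < n) \prod_(j < n | (i < j)%N) (w j - w i))
    * \prod_(j < n | j != i0) (v i0 - v j)
  = (\prod_(i < n) \prod_(j < n | (i < j)%N) (v j - v i))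
    * \prod_(j < n | j != i0) (z - v j).
Proof.
move=> w.
pose rest := \prod_(i < n | i != i0) \prod_(j < n | (i < j)%N && (j != i0))
  (v j - v i).
have split (u : 'I_n -> R) : (forall i, i != i0 -> u i = v i) ->
  \prod_(i < n) \prod_(j < n | (i < j)%N) (u j - u i) =
  \prod_(j < n | (i0 < j)%N) (v j - u i0)
  * (rest * \prod_(i < n | (i < i0)%N) (u i0 - v i)).
  move=> uv; rewrite (bigD1 i0) //=; congr (_ * _).
    by apply: eq_bigr => j ij; rewrite uv // -val_eqE /= gtn_eqF.
  rewrite /rest [X in _ = _ * X](_ : _ =
     \prod_(i < n | i != i0) (if (i < i0)%N then u i0 - v i else 1)).
    rewrite -big_split /=; apply: eq_bigr => i ii0.
    case: ifP => h.
      rewrite (bigD1 i0) //= mulrC uv //; congr (_ * _).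
      by apply: eq_bigr => j /andP[_ ji0]; rewrite !uv.
    rewrite mulr1; apply: eq_big => j.
      by case: eqP => [->|]; rewrite ?andbT ?andbF.
    by case: (eqVneq j i0) => [->|ji0 _]; rewrite ?h // !uv.
  rewrite -big_mkcondr; apply: eq_bigl => i.
  by rewrite -val_eqE /=; case: ltngtP; rewrite ?andbF.
have splitp (z' : R) : \prod_(j < n | j != i0) (z' - v j) =
  \prod_(j < n | (j < i0)%N) (z' - v j) *
  \prod_(j < n | (i0 < j)%N) (z' - v j).
  rewrite (bigID (fun j : 'I_n => (j < i0)%N)) /=; congr (_ * _);
  by apply: eq_bigl => j; rewrite -val_eqE /=; case: ltngtP.
have neg (z' : R) : \prod_(j < n | (i0 < j)%N) (v j - z') =
  (\prod_(j < n | (i0 < j)%N) (-1)) * \prod_(j < n | (i0 < j)%N) (z' - v j).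
  by rewrite -big_split /=; apply: eq_bigr => j _; rewrite mulN1r opprB.
rewrite (split w) => [|i /negbTE]; last by rewrite /w => ->.
rewrite (split v) // {1 2}/w eqxx !splitp !neg; ring.
Qed.

End Determinants.

(** * The Wronskian as a function of its Laguerre indices *)

Section LaguerreRows.

Lemma coefXderiv (R : nzSemiRingType) (p : {poly R}) i :
  ('X * p^`())`_i = p`_i *+ i.
Proof. by rewrite coefXM; case: i => [|i] /=; rewrite ?mulr0n // coef_deriv. Qed.

Lemma coef_mlaguerre (c : A) n i : (mlaguerre c n)`_i =
  (-1) ^+ (n + i) * 'C(n, i)%:R * poch (c + (i.+1)%:R) (n - i).
Proof.
rewrite /mlaguerre coef_sum; case: (leqP i n) => h.
  have hi : (i < n.+1)%N by [].
  rewrite (bigD1 (Ordinal hi)) //= coefZ coefXn eqxx mulr1 big1 ?addr0 // => j.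
  by rewrite -val_eqE /= coefZ coefXn eq_sym => /negbTE ->; rewrite mulr0.
rewrite bin_small // mulr0 mul0r big1 // => j _.
by rewrite coefZ coefXn gtn_eqF ?mulr0 //; have := ltn_ord j; lia.
Qed.

(** Coefficientwise this is (n+1-i) C(n+1,i) = (n+1) C(n,i), while the Pochhammer product loses its
    last factor c+n+1. *)
Lemma mlaguerre_lower (c : A) n :
  n.+1%:R *: mlaguerre c n.+1 - 'X * (mlaguerre c n.+1)^`()
  = - (n.+1%:R * (c + n.+1%:R)) *: mlaguerre c n.
Proof.
apply/polyP=> i; rewrite coefB !coefZ coefXderiv !coef_mlaguerre.
case: (leqP i n) => h; last first.
  rewrite (bin_small h) mulr0 mul0r mulr0.
  case: (ltngtP i n.+1) h => [|h _|-> _]; first by lia.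
    by rewrite bin_small // mulr0 mul0r mulr0 mul0rn subr0.
  by rewrite mulr_natl subrr.
rewrite (_ : n.+1 - i = (n - i).+1)%N; last by lia.
rewrite /poch big_ord_recr /= -mulr_natl.
set P := \prod_(_ < _) _.
have e : n.+1%:R * 'C(n.+1, i)%:R - i%:R * 'C(n.+1, i)%:R
   = n.+1%:R * 'C(n, i)%:R :> A.
  by rewrite -!natrM -natrB ?leq_mul2r ?(leqW h) ?orbT // -mulnBl mul_bin_down.
have e2 : i.+1%:R + (n - i)%:R = n.+1%:R :> A.
  by rewrite -natrD addSn subnKC.
rewrite addSn exprS -addrA e2.
transitivity (- (-1) ^+ (n + i) * P * (c + n.+1%:R) *
  (n.+1%:R * 'C(n.+1, i)%:R - i%:R * 'C(n.+1, i)%:R)); first by ring.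
by rewrite e; ring.
Qed.

(* [x d/dx] conjugated by [x^(sparam sg)]. *)
Definition twist (sg : bool) (q : {poly A}) : {poly A} :=
  'X * q^`() + (sparam sg)%:P * q.

Definition wentry (x : bool * nat) (k : nat) : {poly A} :=
  iter k (twist x.1) (psipoly x.1 x.2).

Definition wr (N : nat) (F : nat -> bool * nat) : {poly A} :=
  \det (\matrix_(i < N, k < N) wentry (F i) k).

(** Eigenvalue of [twist] on the leading monomial of the row. *)
Definition vnode (x : bool * nat) : A := (2 * x.2)%:R + sparam x.1.

Definition vprod (N : nat) (F : nat -> bool * nat) : A :=
  \prod_(i < N) \prod_(j < N | (i < j)%N) (vnode (F j) - vnode (F i)).

(** At index 0 the pair stays as it is; in the lowering relations such a term carries the index as a
    factor and vanishes. *)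
Definition lower (F : nat -> bool * nat) (i : nat) : nat -> bool * nat :=
  fun k => if k == i then ((F k).1, (F k).2.-1) else F k.

Lemma psipoly_lower sg n :
  (2 * n.+1)%:R *: psipoly sg n.+1 - 'X * (psipoly sg n.+1)^`()
  = - (2 * (n.+1%:R * (sparam sg + n.+1%:R))) *: psipoly sg n.
Proof.
have := congr1 (fun p => p \Po 'X^2) (mlaguerre_lower (sparam sg) n).
rewrite /psipoly comp_polyB !comp_polyZ comp_polyM comp_polyX => e.
rewrite deriv_comp derivXn /= -[in RHS]mulrN -scalerA -e.
rewrite scalerBr scalerA -natrM.
by rewrite -!mul_polyC expr1; congr (_ - _); ring.
Qed.

(** The operator x d/dx commutes with [twist], so the relation for [psipoly] passes to all
    iterates. *)
Lemma wentry_lower x k : (0 < x.2)%N ->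
  (2 * x.2)%:R *: wentry x k - 'X * (wentry x k)^`()
  = - (2 * (x.2%:R * (sparam x.1 + x.2%:R))) *: wentry (x.1, x.2.-1) k.
Proof.
case: x => sg [|n] //= _; rewrite /wentry /=.
elim: k => [|k IHk] /=; first exact: psipoly_lower.
move: IHk; set q := iter k _ _; set p := iter k _ _ => IHk.
have := congr1 (twist sg) IHk; rewrite /twist -!mul_polyC.
rewrite !derivD !derivM !derivN !derivM !derivC !derivX => e.
apply: etrans (etrans e _); ring.
Qed.

Lemma coef_wentry x k n :
  (wentry x k)`_n = (n%:R + sparam x.1) ^+ k * (psipoly x.1 x.2)`_n.
Proof.
elim: k => [|k IHk] /=; first by rewrite expr0 mul1r.
by rewrite /wentry /= coefD coefXderiv coefCM IHk exprS -mulr_natl; ring.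
Qed.

Lemma coef_psipoly_top sg m : (psipoly sg m)`_(2 * m) = 1.
Proof.
rewrite /psipoly coef_comp_poly_Xn // dvdn_mulr // mulKn //.
by rewrite coef_mlaguerre binn subnn /poch big_ord0 !mulr1 addnn -mul2n exprM
  sqrrN !expr1n.
Qed.

Lemma size_wentry x k : (size (wentry x k) <= (2 * x.2).+1)%N.
Proof.
apply/leq_sizeP => n hn; rewrite coef_wentry /psipoly coef_comp_poly_Xn //.
case: ifP => [/dvdnP[d def_n]|]; last by rewrite mulr0.
rewrite def_n mulnK // coef_mlaguerre bin_small ?mulr0 ?mul0r ?mulr0 //.
by lia.
Qed.

(** The polynomials [psipoly] are monic and [twist] is diagonal on monomials, so the top
    coefficients form a Vandermonde matrix in the [vnode]. *)
Lemma wr_top N (F : nat -> bool * nat) :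
  (wr N F)`_(\sum_(i < N) 2 * (F i).2) = vprod N F.
Proof.
rewrite /wr (@coef_det_top _ _ _ (fun i : 'I_N => 2 * (F i).2)%N); last first.
  by move=> i j; rewrite mxE size_wentry.
rewrite /vprod.
have := det_Vandermonde (\row_(i < N) vnode (F i)).
under eq_bigr => i _ do under eq_bigr => j _ do rewrite !mxE.
move <-; rewrite -det_tr; congr (\det _); apply/matrixP => i j.
by rewrite !mxE coef_wentry coef_psipoly_top mulr1.
Qed.

Lemma wr_lower N (F : nat -> bool * nat) k :
  ((\sum_(i < N) 2 * (F i).2)%:R - k%:R) * (wr N F)`_k
  = - 2 * \sum_(i < N) ((F i).2%:R * (sparam (F i).1 + (F i).2%:R))
      * (wr N (lower F i))`_k.
Proof.
have := euler_det (\matrix_(i < N, j < N) wentry (F i) j)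
  (fun i : 'I_N => (2 * (F i).2)%:R).
rewrite -natr_sum -/(wr N F) => /(congr1 (fun p : {poly A} => p`_k)).
rewrite coefB coefZ coefXderiv -[_ *+ k]mulr_natl -mulrBl => <-.
rewrite coef_sum mulr_sumr; apply: eq_bigr => i _.
set lhs := \det _.
suff -> : lhs = - (2 * ((F i).2%:R * (sparam (F i).1 + (F i).2%:R)))
   *: wr N (lower F i) by rewrite coefZ; ring.
rewrite /lhs -mul_polyC /wr.
transitivity (\det (\matrix_(a < N, b < N) (if a == i then
  (- (2 * ((F i).2%:R * (sparam (F i).1 + (F i).2%:R))))%:P
   * wentry ((F i).1, (F i).2.-1) b else
  (\matrix_(i < N, j < N) wentry (F i) j) a b))).
  congr (\det _); apply/matrixP => a b; rewrite !mxE; case: eqP => // ->.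
  (* At index 0 the row is constant in x, and both sides are zero. *)
  case: (posnP (F i).2) => [e|/wentry_lower ->]; last by rewrite mul_polyC.
  rewrite e muln0 mul0r mulr0 oppr0 mul0r scale0r sub0r.
  have -> : (wentry (F i) b)^`() = 0; last by rewrite mulr0 oppr0.
  have := size_wentry (F i) b; rewrite e muln0 => /size1_polyC ->.
  by rewrite derivC.
rewrite det_rowZ; congr (_ * \det _); apply/matrixP => a b; rewrite !mxE.
by rewrite /lower val_eqE; case: eqP => // ->.
Qed.

(* Coefficients of the derivatives in [derq] on the iterates of [twist]; they
   are the same for all rows, which is why the determinant does not change. *)
Fixpoint lcoef (j k : nat) : {poly A} :=
  if j is j'.+1 then
    'X * (lcoef j' k)^`() + (if k is k'.+1 then lcoef j' k' else 0)
    + ((2%:R^-1)%:P - j'%:R)%:P * lcoef j' k - 'X^2 * lcoef j' k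
  else (k == 0)%:R.

Lemma lcoef_gt j k : (j < k)%N -> lcoef j k = 0.
Proof.
elim: j k => [|j IHj] [|k] //= jk.
by rewrite !IHj ?(ltnW jk) // derivC !mulr0 !addr0 subr0.
Qed.

Lemma lcoef_diag j : lcoef j j = 1.
Proof.
by elim: j => [|j IHj] //=; rewrite (@lcoef_gt j j.+1) // derivC !mulr0
  IHj add0r addr0 subr0.
Qed.

(** Once [sparam sg] is absorbed into [twist], the remaining factor 1/2 - j - x^2 is independent of
    [sg]; the product rule then yields the recursion of [lcoef]. *)
Lemma derq_lcoef sg q n j : (j < n)%N ->
  derq (expo sg) j q = \sum_(k < n) lcoef j k * iter k (twist sg) q.
Proof.
elim: j => [|j IHj] jn /=.
  case: n jn => // n _; rewrite big_ord_recl /= mul1r big1 ?addr0 // => k _.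
  by rewrite mul0r.
rewrite IHj ?(ltnW jn) //; case: n jn {IHj} => // n jn.
have -> : \sum_(k < n.+1) (lcoef j.+1 k * iter k (twist sg) q) =
  \sum_(k < n.+1) (('X * (lcoef j k)^`()
     + ((2%:R^-1)%:P - j%:R)%:P * lcoef j k - 'X^2 * lcoef j k)
     * iter k (twist sg) q) + \sum_(k < n.+1) lcoef j k * iter k.+1 (twist sg) q.
  (* The shift from [k] to [k.+1] loses nothing at the upper end, as [lcoef j n] is 0 for j < n. *)
  rewrite [X in _ + X]big_ord_recr /= (@lcoef_gt j n) // mul0r addr0.
  rewrite big_ord_recl [X in _ = X + _]big_ord_recl -[RHS]addrA -big_split /=.
  congr (_ + _); first by ring.
  by apply: eq_bigr => k _; ring.
rewrite (raddf_sum (@deriv _)) /= !mulr_sumr -!big_split /= -sumrB.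
apply: eq_bigr => k _; rewrite derivM /expo /twist /= !rmorphB !rmorphD /=.
ring.
Qed.

Lemma wronskpoly_wr ms ns : wronskpoly ms ns =
  wr (size ms + size ns) (nth (true, 0%N) (fam ms ns)).
Proof.
apply: (@det_unitrig_comb _ _ _ _ lcoef) => [i j||].
- rewrite mxE (derq_lcoef _ _ (ltn_ord j)); apply: eq_bigr => k _.
  by rewrite mxE.
- exact: lcoef_diag.
- exact: lcoef_gt.
Qed.

Lemma vdelta_vprod ms ns : vdelta ms ns =
  vprod (size ms + size ns) (nth (true, 0%N) (fam ms ns)).
Proof.
rewrite /vdelta /vprod size_cat !size_map.
have vE (i : 'I_(size ms + size ns)) :
  ([seq (2 * m)%:R + 'X | m <- ms] ++ [seq (2 * n)%:R - 'X | n <- ns])`_i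
  = vnode (nth (true, 0%N) (fam ms ns) i).
  rewrite /fam /vnode !nth_cat !size_map; case: ltnP => h.
    by rewrite !(nth_map 0%N).
  by rewrite !(nth_map 0%N) // ltn_subLR.
by apply: eq_bigr => i _; apply: eq_bigr => j _; rewrite !vE.
Qed.

Lemma eq_wr N F G : (forall i, (i < N)%N -> F i = G i) -> wr N F = wr N G.
Proof.
by move=> FG; congr (\det _); apply/matrixP => i j; rewrite !mxE FG.
Qed.

Lemma eq_vprod N F G :
  (forall i, (i < N)%N -> F i = G i) -> vprod N F = vprod N G.
Proof.
by move=> FG; apply: eq_bigr => i _; apply: eq_bigr => j _; rewrite !FG.
Qed.

Lemma wr_collision N (F : nat -> bool * nat) (i j : 'I_N) :
  i != j -> F i = F j -> wr N F = 0.
Proof.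
by move=> ij Fij; apply: (determinant_alternate ij) => k; rewrite !mxE Fij.
Qed.

End LaguerreRows.

(** * Conjugate partitions as Galois connections *)

Section ConjugateSequences.

(** Both sides say that the box (i, j), counted from zero, lies in the diagram. The relation is
    symmetric, forces both functions to be nonincreasing and fixes no length. *)
Definition conj_rel (l l' : nat -> nat) : Prop :=
  forall i j, (j < l i)%N = (i < l' j)%N.

Definition part_node (l : nat -> nat) (r i : nat) : nat := (l i + (r - 1 - i))%N.

Lemma part_nodeE (R : comNzRingType) (l : nat -> nat) (r i : nat) : (i < r)%N ->
  (part_node l r i)%:R = (l i)%:R - i%:R - 1 + r%:R :> R.
Proof.
move=> ir; have -> : r%:R = (r - 1 - i)%:R + (i%:R + 1) :> R.
  by rewrite natr1 -natrD; congr (_%:R); lia.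
by rewrite natrD; ring.
Qed.

Definition dec (l : nat -> nat) (i : nat) : nat -> nat :=
  fun k => if k == i then (l k).-1 else l k.

Variables (l l' : nat -> nat) (r r' : nat).
Hypotheses (ll' : conj_rel l l') (lr : l r = 0%N) (lr' : l' r' = 0%N).

Lemma conj_rel_sym : conj_rel l' l.
Proof. by move=> i j; rewrite ll'. Qed.

Lemma conj_rel_noninc i k : (i <= k)%N -> (l k <= l i)%N.
Proof.
clear lr lr' => ik; case: (leqP (l k) (l i)) => // h.
have := ll' k (l i); have := ll' i (l i); rewrite h ltnn; lia.
Qed.

Lemma conj_rel_bound j : (l' j <= r)%N.
Proof. by clear lr'; have := ll' r j; rewrite lr; lia. Qed.

(** Counts the boxes of the diagram by columns and by rows. *)
Lemma conj_rel_sum : (\sum_(j < r') l' j = \sum_(i < r) l i)%N.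
Proof.
have bound' i : (l i <= r')%N by have := ll' i r'; rewrite lr'; lia.
have card_lt n m : (m <= n)%N -> (\sum_(i < n) (i < m) = m)%N.
  move=> /minn_idPr {2}<-; elim: n => [|n IHn]; first by rewrite big_ord0 min0n.
  by rewrite big_ord_recr /= IHn; lia.
transitivity (\sum_(j < r') \sum_(i < r) (i < l' j))%N.
  by apply: eq_bigr => j _; rewrite card_lt ?conj_rel_bound.
rewrite exchange_big; apply: eq_bigr => i _ /=.
by under eq_bigr => j _ do rewrite -ll'; rewrite card_lt.
Qed.

Lemma conj_rel_corner i : l i.+1 <> l i ->
  exists2 j, l i = j.+1 & l' j = i.+1.
Proof.
clear lr lr' => ne; have le := conj_rel_noninc (leqnSn i).
exists (l i).-1; first by lia.
by have := ll' i (l i).-1; have := ll' i.+1 (l i).-1; lia.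
Qed.

Lemma conj_rel_dec i j :
  l i = j.+1 -> l' j = i.+1 -> conj_rel (dec l i) (dec l' j).
Proof.
clear lr lr' => li l'j x y; rewrite /dec.
case: (eqVneq x i) => [->|xi]; case: (eqVneq y j) => [->|yj].
- by rewrite li l'j /=; lia.
- by rewrite -ll' li; lia.
- by rewrite ll' l'j; lia.
- exact: ll'.
Qed.

(* The two families of indices are complementary in [0, r + r'[ : this is the
   Maya diagram of a partition read from its rows and from its columns. *)
Lemma maya_prod (R : comNzRingType) (f : nat -> R) :
  (\prod_(i < r) f (part_node l r i))
  * (\prod_(j < r') f (r + j - l' j)%N) = \prod_(k < r + r') f k.
Proof.
have bound' i : (l i <= r')%N by have := ll' i r'; rewrite lr'; lia.
have bound := conj_rel_bound.
have noninc' i k : (i <= k)%N -> (l' k <= l' i)%N.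
  by move=> ik; have := ll' (l' i) i; have := ll' (l' i) k; lia.
pose s1 := [seq (l i + (r - 1 - i))%N | i <- iota 0 r].
pose s2 := [seq (r + j - l' j)%N | j <- iota 0 r'].
have us : uniq (s1 ++ s2).
  rewrite cat_uniq; apply/and3P; split.
  - rewrite map_inj_in_uniq ?iota_uniq // => i k; rewrite !mem_iota => hi hk.
    case: (leqP i k) => [/[dup] h /conj_rel_noninc|
                         /[dup] h /ltnW/conj_rel_noninc]; lia.
  - apply/hasPn => x /mapP[j]; rewrite mem_iota => hj ->.
    apply/negP => /mapP[ i ]; rewrite mem_iota => hi.
    by have := ll' i j; have := bound j; lia.
  - rewrite map_inj_in_uniq ?iota_uniq // => i k; rewrite !mem_iota => hi hk.
    have b1 := bound i; have b2 := bound k; have mono := noninc'.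
    by case: (leqP i k) => [/[dup] h /mono | /[dup] h /ltnW/mono]; lia.
have [_ s12] : (size (s1 ++ s2) = size (iota 0 (r + r'))) *
    (s1 ++ s2 =i iota 0 (r + r')).
  apply: uniq_min_size => // [x|]; last first.
    by rewrite size_iota size_cat !size_map !size_iota.
  rewrite mem_cat mem_iota add0n => /orP[] /mapP[ i ]; rewrite mem_iota => hi ->.
    by have := bound' i; lia.
  by have := bound i; lia.
rewrite -(big_mkord xpredT (fun i => f (l i + (r - 1 - i))%N)).
rewrite -(big_mkord xpredT (fun j => f (r + j - l' j)%N)).
rewrite -(big_mkord xpredT f) /index_iota !subn0.
rewrite -(big_map (fun i => (l i + (r - 1 - i))%N) xpredT f).
rewrite -(big_map (fun j => (r + j - l' j)%N) xpredT f) -big_cat.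
by apply: perm_big; apply: uniq_perm; rewrite ?iota_uniq.
Qed.

(** Uses [maya_prod] for z+k-r and for z+k+1-r: the two full products over k < r+r' agree except for
    the end factors z-r and z+r'. *)
Lemma conj_rel_prod (R : comNzRingType) (z : R) :
  (z + r'%:R) * (\prod_(j < r') (z - (l' j)%:R + j%:R))
    * (\prod_(i < r) (z + (l i)%:R - i%:R - 1))
  = (z - r%:R) * (\prod_(i < r) (z + (l i)%:R - i%:R))
    * (\prod_(j < r') (z - (l' j)%:R + j%:R + 1)).
Proof.
have m1 := maya_prod (fun k => z + k%:R - r%:R).
have m2 := maya_prod (fun k => z + k.+1%:R - r%:R).
have ri (i : 'I_r) := part_nodeE R l (ltn_ord i).
have rj (j : 'I_r') : (r + j - l' j)%:R = r%:R + j%:R - (l' j)%:R :> R.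
  by rewrite natrB ?natrD //; have := conj_rel_bound j; lia.
have : (z + r'%:R) * \prod_(k < r + r') (z + k%:R - r%:R)
  = (z - r%:R) * \prod_(k < r + r') (z + k.+1%:R - r%:R).
  transitivity (\prod_(k < (r + r').+1) (z + k%:R - r%:R)).
    by rewrite big_ord_recr /= mulrC natrD; congr (_ * _); ring.
  by rewrite big_ord_recl /= addr0; congr (_ * _).
rewrite -m1 -m2 => e.
transitivity ((z + r'%:R) *
  (\prod_(i < r) (z + (part_node l r i)%:R - r%:R) *
   \prod_(j < r') (z + (r + j - l' j)%:R - r%:R))).
  rewrite -mulrA; congr (_ * _); rewrite mulrC; congr (_ * _);
  by apply: eq_bigr => i _; rewrite ?ri ?rj; ring.
rewrite e -mulrA; congr (_ * _); congr (_ * _);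
by apply: eq_bigr => i _; rewrite -natr1 ?ri ?rj; ring.
Qed.

(* [conj_rel_prod] divided by [z + c], where [c = j0 - i0] is the content of
   the corner, and evaluated at [z = - c]. *)
Lemma conj_rel_residue (R : idomainType) i0 j0 :
  (i0 < r)%N -> (j0 < r')%N -> l i0 = j0.+1 -> l' j0 = i0.+1 ->
  let c : R := j0%:R - i0%:R in
  (r'%:R - c) * (\prod_(j < r' | val j != j0) (- c - (l' j)%:R + j%:R))
    * (\prod_(i < r | val i != i0) (- c + (l i)%:R - i%:R - 1))
  = (c + r%:R) * (\prod_(i < r | val i != i0) (- c + (l i)%:R - i%:R))
    * (\prod_(j < r' | val j != j0) (- c - (l' j)%:R + j%:R + 1)).
Proof.
move=> ir jr li lj c.
have := conj_rel_prod ('X : {poly R}).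
rewrite (bigD1 (Ordinal jr)) //= (bigD1 (Ordinal ir)) //=.
rewrite [X in _ = _ * X * _](bigD1 (Ordinal ir)) //=.
rewrite [X in _ = _ * X](bigD1 (Ordinal jr)) //= !li !lj.
set P1 := \prod_(_ < r' | _) _; set P2 := \prod_(_ < r | _) _.
set P3 := \prod_(_ < r | _) _; set P4 := \prod_(_ < r' | _) _ => e.
have Xc : 'X + c%:P != 0 by rewrite -size_poly_eq0 size_XaddC.
(* The corner contributes X+c to both sides, together with X+c-1 on the left and X+c+1 on the right;
   at -c these last two become -1 and 1. *)
have {}e : ('X + r'%:R) * ('X + c%:P - 1) * P1 * P2
  = ('X - r%:R) * ('X + c%:P + 1) * P3 * P4.
  apply: (mulIf Xc); rewrite /c rmorphB /= !rmorph_nat.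
  move: e; rewrite -!natr1 => e; apply: etrans (etrans e _); ring.
clearbody c.
have hn n : (n%:R : {poly R}).[- c] = n%:R by rewrite hornerMn hornerC.
have h1 : (1 : {poly R}).[- c] = 1 by rewrite hornerC.
have e1 : P1.[- c] = \prod_(j < r' | val j != j0) (- c - (l' j)%:R + j%:R).
  by rewrite horner_prod; apply: eq_bigr => j _; rewrite !hornerD hornerN hornerX
    !hn.
have e2 : P2.[- c] =
    \prod_(i < r | val i != i0) (- c + (l i)%:R - i%:R - 1).
  by rewrite horner_prod; apply: eq_bigr => i _; rewrite !hornerD !hornerN
    hornerX !hn h1.
have e3 : P3.[- c] = \prod_(i < r | val i != i0) (- c + (l i)%:R - i%:R).
  by rewrite horner_prod; apply: eq_bigr => i _; rewrite !hornerD hornerN hornerX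
    !hn.
have e4 : P4.[- c] =
    \prod_(j < r' | val j != j0) (- c - (l' j)%:R + j%:R + 1).
  by rewrite horner_prod; apply: eq_bigr => j _; rewrite !hornerD !hornerN
    hornerX !hn h1.
have {e} := congr1 (fun p => p.[- c]) e.
rewrite !hornerM e1 e2 e3 e4 !hornerD !hornerN hornerX hornerC !hn h1 => e.
by apply: oppr_inj; apply: etrans (etrans e _); ring.
Qed.

End ConjugateSequences.

(** Rows without a corner contribute nothing, and each corner box is met once from its row and once
    from its column. *)
Lemma sum_corners (V : nmodType) (l l' : nat -> nat) (r r' : nat)
    (x y : nat -> V) :
  conj_rel l l' -> l r = 0%N -> l' r' = 0%N ->
  (forall j, (j < r')%N -> l' j.+1 = l' j -> x j = 0) ->
  (forall i, (i < r)%N -> l i.+1 = l i -> y i = 0) ->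
  (forall i j, (i < r)%N -> (j < r')%N -> l i = j.+1 -> l' j = i.+1 ->
     x j = y i) ->
  \sum_(j < r') x j = \sum_(i < r) y i.
Proof.
move=> ll' lr lr' x0 y0 xy.
have step (k k' : nat -> nat) (n n' : nat) (z : nat -> V) :
    conj_rel k k' -> k n = 0%N ->
    (forall j, (j < n')%N -> k' j.+1 = k' j -> z j = 0) ->
    \sum_(j < n') z j = \sum_(j < n')
       \sum_(i < n) (if (k i == j.+1) && (k' j == i.+1) then z j else 0).
  move=> kk' kn z0; apply: eq_bigr => j _.
  case: (eqVneq (k' j.+1) (k' j)) => [/z0 -> //|/eqP ne].
    by rewrite big1 // => i _; case: ifP.
  have [i kj ki] := conj_rel_corner (conj_rel_sym kk') ne.
  have in_ : (i < n)%N by have := conj_rel_bound kk' kn j; lia.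
  rewrite (bigD1 (Ordinal in_)) //= ki kj !eqxx big1 ?addr0 // => i'.
  by rewrite -val_eqE /= eqSS eq_sym => /negbTE ->; rewrite andbF.
have l'l := conj_rel_sym ll'.
rewrite (step l l' r r' x ll' lr x0) (step l' l r' r y l'l lr' y0).
rewrite exchange_big; apply: eq_bigr => i _; apply: eq_bigr => j _.
by rewrite andbC; case: ifP => // /andP[/eqP e1 /eqP e2]; apply: xy.
Qed.

(** * Weights of the corner boxes *)

Section Weights.
Variable K : fieldType.
Hypothesis K0 : forall m n : nat, (m%:R == n%:R :> K) = (m == n).

(* The weight of box-removal in row [i] of the first partition; for the second
   partition it is the same expression with [- b] in place of [b]. *)
Definition wt (b : K) (l : nat -> nat) (r i : nat) (u : nat -> nat) (s : nat) :
    K :=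
  let m := (part_node l r i)%:R in
  let t := b - r%:R + s%:R in
  m * (t + m)
  * (\prod_(k < r | val k != i)
       ((m - 1 - (part_node l r k)%:R) / (m - (part_node l r k)%:R)))
  * (\prod_(q < s)
       ((m + t - 1 - (part_node u s q)%:R) / (m + t - (part_node u s q)%:R))).

(** If row i+1 has the same length, its node is one less than that of row i and its factor vanishes;
    in the last row the node itself is 0. *)
Lemma wt_flat b l r i u s :
  (i < r)%N -> l r = 0%N -> l i.+1 = l i -> wt b l r i u s = 0.
Proof.
move=> ir lr li; rewrite /wt.
case: (ltnP i.+1 r) => h; last first.
  have -> : part_node l r i = 0%N; last by rewrite !mul0r.
  by rewrite /part_node -li (_ : i.+1 = r) ?lr; lia.
rewrite (bigD1 (Ordinal h)) /=; last by rewrite gtn_eqF.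
have -> : (part_node l r i)%:R = (part_node l r i.+1)%:R + 1 :> K.
  by rewrite natr1 /part_node li; congr (_%:R); lia.
by rewrite addrK subrr !mul0r mulr0 mul0r.
Qed.

Lemma part_node_inj (l l' : nat -> nat) (r i k : nat) :
  conj_rel l l' -> (i < r)%N -> (k < r)%N ->
  part_node l r i = part_node l r k -> i = k.
Proof.
move=> ll' ir kr; rewrite /part_node.
have mono := conj_rel_noninc ll'.
by case: (leqP i k) => [/[dup] h /mono | /[dup] h /ltnW/mono]; lia.
Qed.

(** In terms of [c], which at a corner box is its content, the individual factors of the products no
    longer contain the lengths. *)
Lemma wtE b l r i u s : (i < r)%N ->
  let c : K := (l i)%:R - i%:R - 1 in
  wt b l r i u s = (c + r%:R)
  * (\prod_(k < r | val k != i) (c - (l k)%:R + k%:R)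
     / \prod_(k < r | val k != i) (c - (l k)%:R + k%:R + 1))
  * ((c + b + s%:R) * (\prod_(q < s) (c + b - (u q)%:R + q%:R)
     / \prod_(q < s) (c + b - (u q)%:R + q%:R + 1))).
Proof.
move=> ir c; rewrite /wt (part_nodeE _ _ ir) -/c.
under eq_bigr => k _ do rewrite (part_nodeE _ _ (ltn_ord k)).
under [X in _ * X = _]eq_bigr => q _ do rewrite (part_nodeE _ _ (ltn_ord q)).
rewrite -!prodf_div.
rewrite [X in _ * X * _ = _](eq_bigr (fun k : 'I_r =>
  (c - (l k)%:R + k%:R) / (c - (l k)%:R + k%:R + 1))); last first.
  by move=> k _; congr (_ / _); ring.
rewrite [X in _ * X = _](eq_bigr (fun q : 'I_s =>
  (c + b - (u q)%:R + q%:R) / (c + b - (u q)%:R + q%:R + 1))); last first.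
  by move=> q _; congr (_ / _); ring.
ring.
Qed.

(** Transposition replaces the content c by -c. The factor of the box's own partition is preserved
    by [conj_rel_residue]; the other is handled by [conj_rel_prod] at z = b-c, where z-s = -(c-b+s)
    gives the sign. *)
Lemma wt_dual (b : K) l l' r r' u u' s s' i j :
  (forall m n : nat, b + m%:R != n%:R) ->
  conj_rel l l' -> l r = 0%N -> l' r' = 0%N ->
  conj_rel u u' -> u s = 0%N -> u' s' = 0%N ->
  (i < r)%N -> (j < r')%N -> l i = j.+1 -> l' j = i.+1 ->
  wt b l' r' j u' s' = - wt (- b) l r i u s.
Proof.
move=> bgen ll' lr lr' uu' us us' ir jr li lj.
rewrite !wtE // li lj -!natr1.
have -> : i%:R + 1 - j%:R - 1 = i%:R - j%:R :> K by ring.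
have -> : j%:R + 1 - i%:R - 1 = j%:R - i%:R :> K by ring.
set c : K := j%:R - i%:R; rewrite (_ : i%:R - j%:R = - c); last first.
  by rewrite opprB.
rewrite -mulrN; congr (_ * _).
  have := conj_rel_residue ll' lr lr' K ir jr li lj; rewrite -/c /= => e.
  have flip1 : \prod_(k < r | val k != i) (c - (l k)%:R + k%:R + 1)
     = \prod_(k < r | val k != i) (-1)
     * \prod_(k < r | val k != i) (- c + (l k)%:R - k%:R - 1).
    by rewrite -big_split; apply: eq_bigr => k _ /=; ring.
  have flip0 : \prod_(k < r | val k != i) (c - (l k)%:R + k%:R)
     = \prod_(k < r | val k != i) (-1)
     * \prod_(k < r | val k != i) (- c + (l k)%:R - k%:R).
    by rewrite -big_split; apply: eq_bigr => k _ /=; ring.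
  rewrite flip0 flip1.
  have sgn0 : \prod_(k < r | val k != i) (-1) != 0 :> K.
    by apply/prodf_neq0 => k _; rewrite oppr_eq0 oner_eq0.
  rewrite -mulf_div divff // mul1r addrC.
  (* A zero denominator would identify two nodes of one partition. *)
  have d1 : \prod_(k < r' | val k != j) (- c - (l' k)%:R + k%:R + 1) != 0.
    apply/prodf_neq0 => k kj; apply/eqP => e0.
    have : (part_node l' r' j)%:R == (part_node l' r' k)%:R :> K.
      rewrite !part_nodeE // lj -natr1 -subr_eq0 -e0 /c; apply/eqP; ring.
    rewrite K0 => /eqP/(part_node_inj (conj_rel_sym ll') jr (ltn_ord k)) jk.
    by rewrite jk eqxx in kj.
  have d2 : \prod_(k < r | val k != i) (- c + (l k)%:R - k%:R - 1) != 0.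
    apply/prodf_neq0 => k ki; apply/eqP => e0.
    have : (part_node l r k)%:R == (part_node l r i)%:R :> K.
      rewrite !part_nodeE // li -natr1 -subr_eq0 -e0 /c; apply/eqP; ring.
    rewrite K0 => /eqP/(part_node_inj ll' (ltn_ord k) ir) ki'.
    by move: ki; rewrite /= ki' eqxx.
  by rewrite !mulrA; apply/eqP; rewrite eqr_div //; apply/eqP.
have := conj_rel_prod uu' us us' (- c + b).
have flip1 : \prod_(q < s) (c - b - (u q)%:R + q%:R + 1)
   = \prod_(q < s) (-1) * \prod_(q < s) (- c + b + (u q)%:R - q%:R - 1).
  by rewrite -big_split; apply: eq_bigr => k _ /=; ring.
have flip0 : \prod_(q < s) (c - b - (u q)%:R + q%:R)
   = \prod_(q < s) (-1) * \prod_(q < s) (- c + b + (u q)%:R - q%:R).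
  by rewrite -big_split; apply: eq_bigr => k _ /=; ring.
rewrite flip0 flip1.
have sgn0 : \prod_(q < s) (-1) != 0 :> K.
  by apply/prodf_neq0 => k _; rewrite oppr_eq0 oner_eq0.
rewrite -mulf_div divff // mul1r -mulNr => e.
rewrite (_ : - (c - b + s%:R) = - c + b - s%:R); last by ring.
(* Here a zero would be an equation b+m = n with natural m and n, excluded by [bgen]. *)
have d1 : \prod_(q < s') (- c + b - (u' q)%:R + q%:R + 1) != 0.
  apply/prodf_neq0 => q _; have := bgen (i + q.+1)%N (j + u' q)%N.
  by apply: contra_neq => /eqP e0; rewrite !natrD -natr1; apply/eqP;
    rewrite -subr_eq0 -(eqP e0) /c; apply/eqP; ring.
have d2 : \prod_(q < s) (- c + b + (u q)%:R - q%:R - 1) != 0.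
  apply/prodf_neq0 => q _; have := bgen (i + u q)%N (j + q.+1)%N.
  by apply: contra_neq => /eqP e0; rewrite !natrD -natr1; apply/eqP;
    rewrite -subr_eq0 -(eqP e0) /c; apply/eqP; ring.
by rewrite !mulrA; apply/eqP; rewrite eqr_div //; apply/eqP.
Qed.

End Weights.

(** * Duality of the normalised coefficients *)

Section Duality.
Variables (K : fieldType) (b : K).
Hypothesis K0 : forall m n : nat, (m%:R == n%:R :> K) = (m == n).
Hypothesis bgen : forall m n : nat, b + m%:R != n%:R.
(** The parameter b-r+s varies with the lengths, so each pair of lengths has its own specialisation
    of beta. *)
Variable phi : nat -> nat -> {rmorphism A -> K}.
Hypothesis phiX : forall r s, phi r s 'X = b - r%:R + s%:R.

Lemma two_neq0 : 2 != 0 :> K.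
Proof. by rewrite (K0 2 0). Qed.

Definition nrm (f : A -> K) (N : nat) (F : nat -> bool * nat) (k : nat) : K :=
  f (wr N F)`_k / f (vprod N F).

Lemma rmorph_vprod (f : {rmorphism A -> K}) N (F : nat -> bool * nat) :
  f (vprod N F) = \prod_(i < N) \prod_(j < N | (i < j)%N)
    (f (vnode (F j)) - f (vnode (F i))).
Proof.
rewrite rmorph_prod; apply: eq_bigr => i _.
by rewrite rmorph_prod; apply: eq_bigr => j _; rewrite rmorphB.
Qed.

Lemma vprod_neq0 (f : {rmorphism A -> K}) N (F : nat -> bool * nat) :
  injective (fun x => f (vnode x)) ->
  (forall i j, (i < N)%N -> (j < N)%N -> F i = F j -> i = j) ->
  f (vprod N F) != 0.
Proof.
move=> finj Finj; rewrite rmorph_vprod; apply/prodf_neq0 => i _.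
apply/prodf_neq0 => j ij; rewrite subr_eq0; apply/eqP => /finj.
by move/Finj => /(_ (ltn_ord _) (ltn_ord _)) ji; move: ij; rewrite ji ltnn.
Qed.

(** This is [wr_lower] divided by the Vandermonde product; lowering moves one node by -2, and
    [vandermonde_update] gives the resulting ratio. *)
Lemma nrm_lower (f : {rmorphism A -> K}) N (F : nat -> bool * nat) k :
  injective (fun x => f (vnode x)) ->
  (forall i j, (i < N)%N -> (j < N)%N -> F i = F j -> i = j) ->
  ((\sum_(i < N) 2 * (F i).2)%:R - k%:R) * nrm f N F k
  = - 2 * \sum_(i < N) ((F i).2%:R * (f (sparam (F i).1) + (F i).2%:R))
      * (\prod_(j < N | j != i) ((f (vnode (F i)) - 2 - f (vnode (F j)))
           / (f (vnode (F i)) - f (vnode (F j)))))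
      * nrm f N (lower F i) k.
Proof.
move=> finj Finj; have V0 := vprod_neq0 finj Finj.
apply: (mulIf V0); rewrite /nrm -mulrA divfK //.
have := congr1 f (wr_lower N F k).
rewrite !rmorphM rmorphB rmorphN /= !rmorph_nat => ->.
rewrite -mulrA mulr_suml; congr (_ * _); rewrite rmorph_sum; apply: eq_bigr => i _.
rewrite !rmorphM rmorphD !rmorph_nat.
case: (posnP (F i).2) => [->|Fi]; first by rewrite !mul0r.
rewrite -!mulrA; congr (_ * (_ * _)).
set v := fun j : 'I_N => f (vnode (F j)).
have low (j : 'I_N) : f (vnode (lower F i j)) =
    if j == i then v i - 2 else v j.
  rewrite /lower val_eqE; case: eqP => [->|] //.
  rewrite /v /vnode /=; move: Fi; case: (F i).2 => // n _ /=.
  by rewrite !rmorphD !rmorph_nat !natrM -natr1; ring.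
have e : f (vprod N (lower F i)) * \prod_(j < N | j != i) (v i - v j)
    = f (vprod N F) * \prod_(j < N | j != i) (v i - 2 - v j).
  rewrite !rmorph_vprod -(vandermonde_update v i); congr (_ * _).
  by apply: eq_bigr => a _; apply: eq_bigr => c _; rewrite !low.
rewrite prodf_div.
(* A zero lowered Vandermonde product means two equal rows, so the lowered Wronskian vanishes
   too. *)
case: (eqVneq (f (vprod N (lower F i))) 0) => [V'0|V'0].
  suff -> : wr N (lower F i) = 0 by rewrite coef0 rmorph0 !mul0r mulr0.
  move/eqP: V'0; rewrite rmorph_vprod => /prodf_eq0[a _ /prodf_eq0[c ac]].
  rewrite subr_eq0 => /eqP/finj ca; apply: (@wr_collision _ _ c a) => //.
  by rewrite -val_eqE /= gtn_eqF.
have D0 : \prod_(j < N | j != i) (v i - v j) != 0.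
  apply/prodf_neq0 => j ji; rewrite subr_eq0; apply/eqP => /finj.
  move/Finj => /(_ (ltn_ord _) (ltn_ord _))/val_inj ij.
  by rewrite ij eqxx in ji.
rewrite -/v.
have -> : \prod_(j < N | j != i) (f (vnode (F i)) - 2 - f (vnode (F j)))
  = f (vprod N (lower F i)) * \prod_(j < N | j != i) (v i - v j)
    / f (vprod N F) by rewrite e mulrAC divff // mul1r.
by field; apply/and3P; split.
Qed.

Definition pfam (l : nat -> nat) (r : nat) (u : nat -> nat) (s : nat) :
    nat -> bool * nat :=
  fun k => if (k < r)%N then (true, part_node l r k)
           else (false, part_node u s (k - r)).

Lemma phi_vnode r s sg m : phi r s (vnode (sg, m)) =
  2 * m%:R + (if sg then b - r%:R + s%:R else - (b - r%:R + s%:R)).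
Proof.
rewrite /vnode natrM [phi r s _]rmorphD [phi r s _]rmorphM /= !rmorph_nat.
by case: sg => /=; rewrite ?rmorphN phiX.
Qed.

(** Nodes of opposite type differ, up to sign, by twice b plus an integer, nonzero by [bgen]. *)
Lemma phi_vnode_inj r s : injective (fun x => phi r s (vnode x)).
Proof.
have twoK : forall x y : K, 2 * x = 2 * y -> x = y := mulfI two_neq0.
move=> [[] m] [[] n]; rewrite !phi_vnode => e.
- congr (_, _); apply/eqP; rewrite -K0; apply/eqP/twoK.
  exact: addIr e.
- have /negP[] := bgen (m + s) (n + r); apply/eqP/twoK/subr0_eq.
  move/eqP: e; rewrite -subr_eq0 => /eqP e.
  by apply: etrans e; rewrite !natrD; ring.
- have /negP[] := bgen (n + s) (m + r); apply/eqP/twoK/subr0_eq.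
  move/eqP: (esym e); rewrite -subr_eq0 => /eqP {}e.
  by apply: etrans e; rewrite !natrD; ring.
- congr (_, _); apply/eqP; rewrite -K0; apply/eqP/twoK.
  exact: addIr e.
Qed.

Lemma pfam_inj l l' r u u' s : conj_rel l l' -> conj_rel u u' ->
  forall i j, (i < r + s)%N -> (j < r + s)%N ->
  pfam l r u s i = pfam l r u s j -> i = j.
Proof.
move=> ll' uu' i j ir jr; rewrite /pfam.
case: (ltnP i r) => hi; case: (ltnP j r) => hj //.
  by case=> /(part_node_inj ll' hi hj).
case=> /(part_node_inj uu'); rewrite !ltn_subLR // => /(_ ir jr); lia.
Qed.

(** The staircase contributes r(r-1), the part of the exponent recorded by [eshift]. *)
Lemma sum_part_node l r :
  (\sum_(i < r) 2 * part_node l r i = r * (r - 1) + 2 * \sum_(i < r) l i)%N.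
Proof.
have stair : (\sum_(i < r) 2 * (r - 1 - i) = r * (r - 1))%N.
  elim: r => [|n IHn]; first by rewrite big_ord0.
  rewrite big_ord_recl /= (eq_bigr (fun i : 'I_n => 2 * (n - 1 - i))%N).
    by rewrite IHn; case: n {IHn} => // n; nia.
  by move=> i _; rewrite /bump; lia.
rewrite -stair big_distrr -big_split /=; apply: eq_bigr => i _.
by rewrite /part_node; lia.
Qed.

Lemma sum_pfam l r u s : (\sum_(i < r + s) 2 * (pfam l r u s i).2
  = eshift r s + 2 * (\sum_(i < r) l i + \sum_(q < s) u q))%N.
Proof.
rewrite big_split_ord /= (eq_bigr (fun i : 'I_r => 2 * part_node l r i)%N).
  rewrite sum_part_node (eq_bigr (fun q : 'I_s => 2 * part_node u s q)%N).
    by rewrite sum_part_node /eshift mulnDr addnACA.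
  by move=> q _; rewrite /pfam ltnNge leq_addr addKn.
by move=> i _; rewrite /pfam ltn_ord.
Qed.

Definition ncoef l r u s k : K :=
  nrm (phi r s) (r + s) (pfam l r u s) (eshift r s + 2 * k).

Lemma ncoef_top l l' r u u' s : conj_rel l l' -> conj_rel u u' ->
  ncoef l r u s (\sum_(i < r) l i + \sum_(q < s) u q) = 1.
Proof.
move=> ll' uu'; rewrite /ncoef /nrm -sum_pfam wr_top divff //.
apply: vprod_neq0; first exact: phi_vnode_inj.
exact: pfam_inj ll' uu'.
Qed.

Lemma ncoef_lower l l' r u u' s k : conj_rel l l' -> conj_rel u u' ->
  ((\sum_(i < r) l i + \sum_(q < s) u q)%:R - k%:R) * ncoef l r u s k
  = - (\sum_(i < r) wt b l r i u s
         * nrm (phi r s) (r + s) (lower (pfam l r u s) i) (eshift r s + 2 * k)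
       + \sum_(q < s) wt (- b) u s q l r
         * nrm (phi r s) (r + s) (lower (pfam l r u s) (r + q))
             (eshift r s + 2 * k)).
Proof.
move=> ll' uu'.
have := nrm_lower (eshift r s + 2 * k) (@phi_vnode_inj r s)
  (@pfam_inj l l' r u u' s ll' uu').
rewrite sum_pfam -/(ncoef l r u s k) => e.
apply: (mulfI two_neq0); rewrite mulrN -mulNr.
transitivity (((eshift r s + 2 * (\sum_(i < r) l i + \sum_(q < s) u q))%:R -
     (eshift r s + 2 * k)%:R) * ncoef l r u s k).
  by rewrite !(natrD, natrM); ring.
rewrite e; congr (_ * _); rewrite big_split_ord /=.
have pl (i : 'I_r) : pfam l r u s i = (true, part_node l r i).
  by rewrite /pfam ltn_ord.
have pr (q : 'I_s) : pfam l r u s (r + q) = (false, part_node u s q).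
  by rewrite /pfam ltnNge leq_addr addKn.
(* Node differences are twice those in [wt]; the factor 2 cancels in every ratio. *)
have half (x y : K) : (2 * x) / (2 * y) = x / y.
  by rewrite -mulf_div divff ?two_neq0 ?mul1r.
congr (_ + _); apply: eq_bigr => i _; congr (_ * _).
  rewrite pl big_split_ord /= /wt phiX mulrA; congr (_ * _ * _).
    apply: eq_big => [j|j _]; first by rewrite eq_lshift.
    by rewrite pl !phi_vnode -[RHS]half; congr (_ / _); ring.
  apply: eq_big => [j|j _]; first by rewrite eq_rlshift.
  by rewrite pr !phi_vnode -[RHS]half; congr (_ / _); ring.
rewrite pr big_split_ord /= /wt rmorphN phiX mulrA mulrAC; congr (_ * _ * _ * _).
- by ring.
- apply: eq_big => [j|j _]; first by rewrite eq_rshift.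
  by rewrite pr !phi_vnode -[RHS]half; congr (_ / _); ring.
- apply: eq_big => [j|j _]; first by rewrite eq_lrshift.
  by rewrite pl !phi_vnode -[RHS]half; congr (_ / _); ring.
Qed.

Lemma lower_pfam_l l r u s j : (0 < l j)%N -> (j < r)%N ->
  forall k, lower (pfam l r u s) j k = pfam (dec l j) r u s k.
Proof.
move=> lj jr k; rewrite /lower /pfam /part_node /dec.
by case: (eqVneq k j) => [->|kj] //; rewrite jr /=; congr (_, _); lia.
Qed.

Lemma lower_pfam_r l r u s q : (0 < u q)%N ->
  forall k, lower (pfam l r u s) (r + q) k = pfam l r (dec u q) s k.
Proof.
move=> uq k; rewrite /lower /pfam /part_node /dec.
case: (eqVneq k (r + q)%N) => [->|kj].
  by rewrite ltnNge leq_addr addKn /= eqxx; congr (_, _); lia.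
by case: ltnP => // rk; rewrite ifN //; apply/eqP => e; move/eqP: kj; lia.
Qed.

Lemma sum_dec l r i : (i < r)%N -> (0 < l i)%N ->
  ((\sum_(k < r) dec l i k).+1 = \sum_(k < r) l k)%N.
Proof.
move=> ir li; rewrite (bigD1 (Ordinal ir)) //= [in RHS](bigD1 (Ordinal ir)) //=.
rewrite /dec eqxx (eq_bigr (fun k : 'I_r => l k)) => [|k]; first by lia.
by rewrite -val_eqE /= => /negbTE ->.
Qed.

Lemma eq_nrm f N F G k : (forall i, F i = G i) -> nrm f N F k = nrm f N G k.
Proof.
by move=> FG; rewrite /nrm (@eq_wr N F G) ?(@eq_vprod N F G).
Qed.

(** On the right [u] stands first, so the rows of [l'] are matched with those of [l] in the second
    slot. Removing a box lowers the exponent of -1 by one, which compensates the sign in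
    [wt_dual]. *)
Lemma ncoef_dual l l' u u' r r' s s' k :
  conj_rel l l' -> l r = 0%N -> l' r' = 0%N ->
  conj_rel u u' -> u s = 0%N -> u' s' = 0%N ->
  ncoef l' r' u' s' k
  = (-1) ^+ (\sum_(i < r) l i + \sum_(q < s) u q + k) * ncoef u s l r k.
Proof.
move=> ll' lr lr' uu' us us'.
have [n] := ubnP (\sum_(i < r) l i + \sum_(q < s) u q)%N.
elim: n l l' u u' ll' lr lr' uu' us us' => // n IHn l l' u u'.
move=> ll' lr lr' uu' us us'; rewrite ltnS => le_n.
have l'l := conj_rel_sym ll'; have u'u := conj_rel_sym uu'.
set w := (\sum_(i < r) l i + \sum_(q < s) u q)%N in le_n *.
have w' : (\sum_(i < r') l' i + \sum_(q < s') u' q = w)%N.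
  by rewrite (conj_rel_sum ll' lr lr') (conj_rel_sum uu' us us').
have wC : (\sum_(i < s) u i + \sum_(q < r) l q = w)%N by rewrite addnC.
(* For k = w both coefficients are 1 and the sign has exponent 2w. *)
case: (eqVneq k w) => [->|kw].
  by rewrite -[in LHS]w' -[in RHS]wC (ncoef_top _ _ l'l u'u)
    (ncoef_top _ _ uu' ll') addnn -mul2n exprM sqrrN !expr1n mulr1.
have kw0 : w%:R - k%:R != 0 :> K by rewrite subr_eq0 K0 eq_sym.
have e1 := ncoef_lower r' s' k l'l u'u; rewrite w' in e1.
have e2 := ncoef_lower s r k uu' ll'; rewrite wC in e2.
apply: (mulfI kw0); rewrite e1 mulrCA e2.
rewrite mulrN mulrDr [in RHS]addrC !mulr_sumr; congr (- (_ + _)).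
- apply: (@sum_corners _ l l' r r'
    (fun j => wt b l' r' j u' s' * nrm (phi r' s') (r' + s')
       (lower (pfam l' r' u' s') j) (eshift r' s' + 2 * k))
    (fun i => (-1) ^+ (w + k) * (wt (- b) l r i u s * nrm (phi s r) (s + r)
       (lower (pfam u s l r) (s + i)) (eshift s r + 2 * k)))) =>
    [||| j jr e|i ir e|i j ir jr li lj] //.
  + by rewrite (wt_flat _ _ _ jr) // mul0r.
  + by rewrite (wt_flat _ _ _ ir) // mul0r mulr0.
  rewrite (wt_dual K0 bgen ll' lr lr' uu' us us' ir jr li lj).
  rewrite (eq_nrm _ _ _ (lower_pfam_l _ _ _ jr)) ?lj //.
  rewrite (eq_nrm _ _ _ (lower_pfam_r _ _ _ _)) ?li // -!/(ncoef _ _ _ _ _).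
  have li0 : (0 < l i)%N by rewrite li.
  have sd := sum_dec ir li0.
  rewrite (IHn (dec l i) (dec l' j) u u') //; first last.
  - by rewrite /w -sd in le_n *; lia.
  - by rewrite /dec lr'; case: eqP.
  - by rewrite /dec lr; case: eqP.
  - exact: conj_rel_dec.
  by rewrite /w -sd !addSn exprS; ring.
- apply: (@sum_corners _ u u' s s'
    (fun j => wt (- b) u' s' j l' r' * nrm (phi r' s') (r' + s')
       (lower (pfam l' r' u' s') (r' + j)) (eshift r' s' + 2 * k))
    (fun i => (-1) ^+ (w + k) * (wt b u s i l r * nrm (phi s r) (s + r)
       (lower (pfam u s l r) i) (eshift s r + 2 * k)))) =>
    [||| j jr e|i ir e|i j ir jr ui uj] //.
  + by rewrite (wt_flat _ _ _ jr) // mul0r.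
  + by rewrite (wt_flat _ _ _ ir) // mul0r mulr0.
  have bgen' m m' : - b + m%:R != m'%:R.
    have := bgen m' m; apply: contra_neq => e.
    by rewrite -e addrA addrN add0r.
  rewrite (wt_dual K0 bgen' uu' us us' ll' lr lr' ir jr ui uj) opprK.
  rewrite (eq_nrm _ _ _ (lower_pfam_r _ _ _ _)) ?uj //.
  rewrite (eq_nrm _ _ _ (lower_pfam_l _ _ _ ir)) ?ui // -!/(ncoef _ _ _ _ _).
  have ui0 : (0 < u i)%N by rewrite ui.
  have sd := sum_dec ir ui0.
  rewrite (IHn l l' (dec u i) (dec u' j)) //; first last.
  - by rewrite /w -sd in le_n *; lia.
  - by rewrite /dec us'; case: eqP.
  - by rewrite /dec us; case: eqP.
  - exact: conj_rel_dec.
  by rewrite /w -sd !addnS addSn exprS; ring.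
Qed.

End Duality.

(** * Partitions as lists and their conjugates *)

Section Partitions.

(** In a nonincreasing list the entries above [j] form an initial segment. *)
Lemma count_gt_nth (s : seq nat) i j : sorted (fun x y => (y <= x)%N) s ->
  (i < count (fun x => j < x) s)%N = (j < nth 0%N s i)%N.
Proof.
elim: s i => [|x s IHs] i /= xs; first by rewrite nth_nil.
have /allP le_x : all (fun y => (y <= x)%N) s.
  by apply: order_path_min xs => a b c /=; lia.
have {}IHs k := IHs k (path_sorted xs).
case: (ltnP j x) => jx /=; first by case: i => [|i] /=; rewrite add1n ?jx ?ltnS ?IHs.
have s0 : count (fun x => j < x)%N s = 0%N.
  by apply/eqP; rewrite -leqn0 leqNgt -has_count; apply/hasPn => y /le_x; lia.
by case: i => [|i] /=; [lia | rewrite -IHs s0].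
Qed.

Lemma nth_conjp s j : is_partition s ->
  nth 0%N (conjp s) j = count (fun x => j < x)%N s.
Proof.
case/andP=> ss _; case: (ltnP j (head 0%N s)) => h; first by rewrite nth_mkseq.
rewrite nth_default ?size_mkseq //; apply/esym/eqP.
by rewrite -leqn0 leqNgt (count_gt_nth _ _ ss) nth0 -leqNgt.
Qed.

Lemma conjp_rel s : is_partition s -> conj_rel (nth 0%N s) (nth 0%N (conjp s)).
Proof.
by move=> ps i j; rewrite nth_conjp // count_gt_nth //; case/andP: ps.
Qed.

Lemma conj_rel_inj l l1 l2 : conj_rel l l1 -> conj_rel l l2 -> l1 =1 l2.
Proof.
move=> h1 h2 j; have := h1 (l1 j) j; have := h1 (l2 j) j.
by rewrite !h2; lia.
Qed.

Lemma size_conjp s : size (conjp s) = head 0%N s.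
Proof. exact: size_mkseq. Qed.

Lemma conjp_partition s : is_partition s -> is_partition (conjp s).
Proof.
move=> ps; apply/andP; split.
  apply/(sortedP 0%N) => i _.
  by have := conj_rel_noninc (conj_rel_sym (conjp_rel ps)) (leqnSn i).
apply/(all_nthP 0%N) => j; rewrite size_conjp => hj.
by rewrite -(conjp_rel ps) nth0.
Qed.

Lemma conjpK s : is_partition s -> conjp (conjp s) = s.
Proof.
move=> ps; have ps' := conjp_partition ps.
have e := conj_rel_inj (conjp_rel ps') (conj_rel_sym (conjp_rel ps)).
apply: (@eq_from_nth _ 0%N) => [|i _]; last exact: e.
(* The first part of the conjugate counts the positive parts, which are all of them. *)
rewrite size_conjp -nth0 nth_conjp //; case/andP: ps => _.
by rewrite all_count => /eqP.
Qed.

Lemma psize_sum s : psize s = (\sum_(i < size s) nth 0%N s i)%N.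
Proof. by rewrite /psize sumnE (big_nth 0%N) big_mkord. Qed.

Lemma psize_conjp s : is_partition s -> psize (conjp s) = psize s.
Proof.
move=> ps; rewrite !psize_sum.
by apply: (conj_rel_sum (conjp_rel ps)); rewrite nth_default.
Qed.

Lemma nth_fam_plus_delta lam mu r s i : (i < r + s)%N ->
  nth (true, 0%N) (fam (plus_delta lam r) (plus_delta mu s)) i
  = pfam (nth 0%N lam) r (nth 0%N mu) s i.
Proof.
move=> irs; rewrite /fam /pfam nth_cat size_map size_mkseq.
case: ltnP => h; first by rewrite (nth_map 0%N) ?size_mkseq // nth_mkseq.
by rewrite (nth_map 0%N) ?size_mkseq ?nth_mkseq // ltn_subLR.
Qed.

End Partitions.

(** * From [Q(beta)] back to [Phi] *)

Section Specialisation.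

Definition shiftX (r s : nat) : A := 'X - r%:R + s%:R.

Lemma size_shiftX r s : size (shiftX r s) = 2.
Proof.
by rewrite /shiftX -!polyC_natr -addrA -polyCN -polyCD size_XaddC.
Qed.

(** Substituting a polynomial of degree 1 preserves degrees, so it carries quotient and remainder to
    quotient and remainder. *)
Lemma comp_divp (F : fieldType) (p d q : {poly F}) : size q = 2 ->
  (p %/ d) \Po q = (p \Po q) %/ (d \Po q).
Proof.
move=> sq; case: (eqVneq d 0) => [->|d0].
  by rewrite divp0 !comp_poly0 divp0.
apply: (@divpP _ _ _ _ ((p %% d) \Po q)).
  by rewrite {1}(divp_eq p d) comp_polyD comp_polyM.
by rewrite !size_comp_poly2 // ltn_modp.
Qed.

(** A common factor does not change a quotient, so both sides can be given the denominator
    [b * d]. *)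
Lemma divp_cross (F : fieldType) (a b c d : {poly F}) :
  b != 0 -> d != 0 -> a * d = c * b -> a %/ b = c %/ d.
Proof.
move=> b0 d0 e.
by rewrite -(divp_pmul2r a d0 b0) e mulrC -(divp_pmul2r c b0 d0) [d * b]mulrC
  [c * b]mulrC.
Qed.

Lemma divf_cross (F : fieldType) (x y c z t : F) :
  y != 0 -> t != 0 -> x / y = c * (z / t) -> x * t = c * z * y.
Proof. by move=> y0 t0 /eqP; rewrite mulrA eqr_div // => /eqP. Qed.

Lemma coef_compNX (R : comNzRingType) (p : {poly R}) k :
  (p \Po (- 'X))`_k = (-1) ^+ k * p`_k.
Proof.
rewrite coef_comp_poly.
have e (i : 'I_(size p)) : true -> p`_i * ((- 'X) ^+ i)`_k =
    if val i == k then (-1) ^+ k * p`_k else 0.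
  move=> _; rewrite -scaleN1r exprZn coefZ coefXn eq_sym.
  case: eqP => [->|]; last by rewrite !mulr0.
  by rewrite mulr1 mulrC.
rewrite (eq_bigr _ e) -big_mkcond; case: (ltnP k (size p)) => h.
  by rewrite (big_pred1 (Ordinal h)) // => i; rewrite /= -val_eqE.
rewrite big_pred0 ?nth_default ?mulr0 // => i.
by apply/negbTE; rewrite neq_ltn (leq_trans (ltn_ord i)).
Qed.

(** The case where b is beta itself, seen in Q(beta). *)
Definition phiF (r s : nat) : {rmorphism A -> {fraction A}} :=
  @tofrac A \o comp_poly (shiftX r s).

Lemma fracK0 (m n : nat) : (m%:R == n%:R :> {fraction A}) = (m == n).
Proof.
rewrite -!(rmorph_nat (@tofrac A)) tofrac_eq -!polyC_natr (inj_eq polyC_inj).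
exact: eqr_nat.
Qed.

Lemma frac_gen (m n : nat) : tofrac 'X + m%:R != n%:R :> {fraction A}.
Proof.
rewrite -!(rmorph_nat (@tofrac A)) -tofracD tofrac_eq; apply/eqP.
move/(congr1 (fun p : A => size p)).
by rewrite -!polyC_natr size_XaddC size_polyC; case: eqP.
Qed.

Lemma phiFX r s : phiF r s 'X = tofrac 'X - r%:R + s%:R.
Proof.
by rewrite /phiF /= comp_polyX /shiftX tofracD tofracB !(rmorph_nat (@tofrac A)).
Qed.

Definition phicoef lam mu k : A :=
  (tildePhi (plus_delta lam (size lam)) (plus_delta mu (size mu)))`_k
    \Po shiftX (size lam) (size mu).

Definition pwr lam mu k : A :=
  (wr (size lam + size mu)
     (pfam (nth 0%N lam) (size lam) (nth 0%N mu) (size mu)))`_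
    (eshift (size lam) (size mu) + 2 * k) \Po shiftX (size lam) (size mu).

Definition pvd lam mu : A :=
  vprod (size lam + size mu)
     (pfam (nth 0%N lam) (size lam) (nth 0%N mu) (size mu))
  \Po shiftX (size lam) (size mu).

Lemma phicoefE lam mu k : phicoef lam mu k = pwr lam mu k %/ pvd lam mu.
Proof.
rewrite /phicoef /tildePhi coef_poly wronskpoly_wr vdelta_vprod !size_mkseq.
rewrite (eq_wr (G := pfam (nth 0%N lam) (size lam) (nth 0%N mu) (size mu)));
  last by move=> i; apply: nth_fam_plus_delta.
rewrite (eq_vprod (G := pfam (nth 0%N lam) (size lam) (nth 0%N mu) (size mu)));
  last by move=> i; apply: nth_fam_plus_delta.
rewrite /pwr /pvd; set W := wr _ _; case: ifP => h.
  by rewrite comp_divp // size_shiftX.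
(* Outside the range of the defining [\poly] the coefficient of W is 0 as well, its index being at
   least k. *)
rewrite [W`_ _]nth_default ?comp_poly0 ?div0p //.
by move/negbT: h; rewrite -leqNgt => /leq_trans; apply; lia.
Qed.

Lemma coef_Phi b lam mu k :
  (Phi b lam mu)`_k = (map_poly (@ratr CC) (phicoef lam mu k)).[b].
Proof.
rewrite /Phi /evbeta coef_map_id0 ?rmorph0 ?horner0 // /phicoef.
rewrite (map_comp_poly (@ratr CC)) horner_comp; congr (_.[_]).
rewrite /shiftX !rmorphD rmorphN /= map_polyX !rmorph_nat.
by rewrite !hornerD hornerN hornerX -!polyC_natr !hornerC.
Qed.

Lemma pvd_neq0 lam mu : is_partition lam -> is_partition mu -> pvd lam mu != 0.
Proof.
move=> pl pm.
have := vprod_neq0 (@phi_vnode_inj _ _ fracK0 frac_gen _ phiFX (size lam) (size mu))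
  (@pfam_inj _ _ (size lam) _ _ (size mu) (conjp_rel pl) (conjp_rel pm)).
by rewrite /phiF /= tofrac_eq0.
Qed.

(** The identity [ncoef_dual] in Q(beta), cleared of denominators, holds in Q[beta] and passes to
    the quotients by [divp_cross]. *)
Lemma phicoef_conjp lam mu k : is_partition lam -> is_partition mu ->
  phicoef (conjp lam) (conjp mu) k
  = (-1) ^+ (psize lam + psize mu + k) * phicoef mu lam k.
Proof.
move=> pl pm.
have pl' := conjp_partition pl; have pm' := conjp_partition pm.
have := @ncoef_dual _ _ fracK0 frac_gen _ phiFX _ _ _ _ (size lam)
  (size (conjp lam)) (size mu) (size (conjp mu)) k
  (conjp_rel pl) (nth_default _ (leqnn _)) (nth_default _ (leqnn _))
  (conjp_rel pm) (nth_default _ (leqnn _)) (nth_default _ (leqnn _)).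
rewrite -!psize_sum /ncoef /nrm /phiF /= -/(pwr _ _ _) -/(pvd _ _).
rewrite -/(pwr _ _ _) -/(pvd _ _) => e.
have v0 := pvd_neq0 pm pl; have v0' := pvd_neq0 pl' pm'.
rewrite !phicoefE; set n := (_ + k)%N in e *.
have -> : (-1) ^+ n * (pwr mu lam k %/ pvd mu lam) =
   ((-1) ^+ n * pwr mu lam k) %/ pvd mu lam.
  rewrite -signr_odd; case: (odd n); rewrite ?expr1 ?expr0 ?mul1r //.
  by rewrite !mulN1r divpN.
apply: divp_cross => //; apply/eqP; rewrite -tofrac_eq !tofracM tofracXn tofracN.
rewrite tofrac1; apply/eqP.
have tv0 : tofrac (pvd mu lam) != 0 by rewrite tofrac_eq0.
have tv0' : tofrac (pvd (conjp lam) (conjp mu)) != 0 by rewrite tofrac_eq0.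
exact: divf_cross tv0' tv0 e.
Qed.

End Specialisation.

Lemma Phi_conjp (lam mu : seq nat) (b : CC) :
  is_partition lam -> is_partition mu ->
  Phi b (conjp lam) (conjp mu)
    = (-1) ^+ (psize lam + psize mu) *: (Phi b mu lam \Po (- 'X)).
Proof.
move=> pl pm; apply/polyP => k.
(* The factor (-1)^k of the sign is the one produced by y -> -y. *)
rewrite coefZ coef_compNX !coef_Phi phicoef_conjp // rmorphM hornerM mulrA -exprD.
by rewrite rmorphXn rmorphN1 horner_exp hornerN hornerC.
Qed.

Theorem theorem3p1 (lam mu : seq nat) (b : CC) :
  is_partition lam -> is_partition mu ->
  Phi b (conjp lam) (conjp mu)
    = (-1) ^+ (psize lam + psize mu) *: (Phi b mu lam \Po (- 'X))
  /\ Phi b lam (conjp lam) \Po (- 'X) = Phi b lam (conjp lam).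
Proof.
move=> pl pm; split; first exact: Phi_conjp.
(* Reading [lam] on the right as a double conjugate, the duality applies to the pair [conjp lam],
   [lam], with sign exponent 2|lam|. *)
rewrite -{3}(conjpK pl) (Phi_conjp b (conjp_partition pl) pl) psize_conjp //.
by rewrite addnn -signr_odd odd_double expr0 scale1r.
Qed.
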